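(* Over the complex scalar field, both $\ell_\infty^2(\mathbb{C})$ and $\ell_\infty^3(\mathbb{C})$ have Property Q; that is, for $n\in\{2,3\}$ and every non-negative definite $B\in\ell_\infty^n(\mathbb{C})\otimes\ell_\infty^n(\mathbb{C})$ one has $\|B\|_\pi=\|B\|_\epsilon$.
   Context: Let $X$ be a finite-dimensional normed space with basis $e_1,\dots,e_n$ (the canonical basis when $X=\ell_\infty^n(\mathbb C)$). An element $A=\sum_{i,j}a_{ij}\,e_i\otimes e_j\in X\otimes X$ is non-negative definite if the matrix $(a_{ij})$ is (Hermitian) non-negative definite. The injective norm is $\|A\|_\epsilon=\sup\{\|A(\lambda)\|_X:\lambda\in X^*,\ \|\lambda\|_{X^*}=1\}$, where $A(\lambda)=\sum_{i,j}a_{ij}\lambda(e_i)e_j$. The projective norm is $\|A\|_\pi=\inf\{\sum_{k=1}^N\|v_k\|\,\|w_k\| : A=\sum_{k=1}^N v_k\otimes w_k,\ v_k,w_k\in X,\ N\in\mathbb{N}\}$. $X$ has Property Q if $\|B\|_\pi=\|B\|_\epsilon$ for all non-negative definite $B\in X\otimes X$. *)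

(* Defs.v *)
From HB Require Import structures.
From mathcomp Require Import all_boot all_order all_algebra.
From mathcomp Require Import complex.
From mathcomp Require Import all_classical all_reals all_analysis.

Set Implicit Arguments.
Unset Strict Implicit.
Unset Printing Implicit Defensive.

Import Order.TTheory GRing.Theory Num.Theory.
Import numFieldNormedType.Exports.

Local Open Scope classical_set_scope.
Local Open Scope ring_scope.
Local Open Scope complex_scope.

(* The norm of a normed R[i]-module takes its values in R[i], where it is a
   nonnegative real; [rnorm] is the same number viewed in R. *)
Definition rnorm (R : realType) (W : normedZmodType R[i]) (v : W) : R :=
  complex.Re `|v|.

Section PropertyQ.
Variables (R : realType) (X : normedModType R[i]) (n : nat) (e : 'I_n -> X).

(* Here e is meant to be a basis of X.  An element sum_ij a_ij e_i (x) e_j of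
   X (x) X is represented by its coordinate matrix (a_ij), and an element of X,
   where coordinates are needed, by its coordinate row vector. *)

Definition of_coords (x : 'rV[R[i]]_n) : X := \sum_i x 0 i *: e i.

(* Every linear form on a finite-dimensional X is continuous, so {scalar X} is
   the whole dual X^*. *)
Definition dual_norm (l : {scalar X}) : R :=
  sup [set rnorm (l v) | v in [set v : X | rnorm v <= 1]].

Definition tensor_apply (A : 'M[R[i]]_n) (l : {scalar X}) : X :=
  \sum_i \sum_j (A i j * l (e i)) *: e j.

Definition injective_norm (A : 'M[R[i]]_n) : R :=
  sup [set rnorm (tensor_apply A l) | l in [set l : {scalar X} | dual_norm l = 1]].

(* The coordinate matrix of v (x) w is x^T *m y when x and y are the
   coordinates of v and w (no conjugation). *)
Definition tensor_decomposition (A : 'M[R[i]]_n)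
    (s : seq ('rV[R[i]]_n * 'rV[R[i]]_n)) : Prop :=
  A = \sum_(p <- s) p.1^T *m p.2.

Definition projective_norm (A : 'M[R[i]]_n) : R :=
  inf [set \sum_(p <- s) rnorm (of_coords p.1) * rnorm (of_coords p.2)
      | s in tensor_decomposition A].

(* [0 <= z] in R[i] means that z is real and nonnegative. *)
Definition nonneg_definite (A : 'M[R[i]]_n) : Prop :=
  A \is hermsymmx /\
  forall u : 'cV[R[i]]_n, 0 <= ((map_mx Num.conj u)^T *m A *m u) 0 0.

Definition property_Q : Prop :=
  forall B : 'M[R[i]]_n, nonneg_definite B ->
    projective_norm B = injective_norm B.

End PropertyQ.

(* The library's norm on matrices is the maximum of the moduli of the entries
   (see [rnorm_linfE]), so 'rV[R[i]]_n is l_infty^n(C). *)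
Notation linf R n := ('rV[R[i]]_n) (only parsing).

Definition canonical_basis (R : realType) (n : nat) (i : 'I_n) : linf R n :=
  delta_mx 0 i.

Lemma of_coords_canonical (R : realType) (n : nat) (x : linf R n) :
  of_coords (@canonical_basis R n) x = x.
Proof. by rewrite [RHS]row_sum_delta. Qed.

Lemma rnorm_linfE (R : realType) (n : nat) (x : linf R n) :
  rnorm x = \big[Num.max/0]_(i < n) rnorm (x 0 i).
Proof.
have rnormC (W : normedZmodType R[i]) (v : W) : (rnorm v)%:C = `|v|.
  by rewrite /rnorm RRe_real// ger0_real.
have ge0 (W : normedZmodType R[i]) (v : W) : 0 <= rnorm v.
  by rewrite -(@lecR R) rnormC normr_ge0.
have hi (i : 'I_n) : rnorm (x 0 i) <= rnorm x.
  rewrite -(@lecR R) !rnormC.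
  change (`|x 0 i|%:nng%:num <= (\big[Num.max/0%:nng]_ij `|x ij.1 ij.2|%:nng)%:num).
  rewrite num_le.
  exact: (le_bigmax _ (fun ij : 'I_1 * 'I_n => `|x ij.1 ij.2|%:nng) (0, i)).
apply/eqP; rewrite eq_le; apply/andP; split; last first.
  by apply/bigmax_leP; split => // i _; exact: hi.
have [x0|x0] := eqVneq (mx_norm x) 0.
  by rewrite /rnorm {1}/Num.Def.normr /= x0 /=; apply: bigmax_ge_id.
have [[i j] /= Hij] := mx_norm_neq0 x0.
have -> : rnorm x = rnorm (x 0 j) by rewrite /rnorm {1}/Num.Def.normr /= Hij ord1.
exact: (le_bigmax _ (fun i => rnorm (x 0 i)) j).
Qed.

(* Main.v *)
(** Write a non-negative definite [B] as [V V^*].  If [u] is a vector such that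
    [|(V u)_i|^2] is proportional to [B_ii], a unitary change of basis sending
    the first basis vector to [u / |u|] gives [V V^* = x x^* + V' V'^*], where
    [x] is a multiple of [V u] and [V'] has one column less; the diagonal of
    [V' V'^*] is again proportional to that of [B].  Such a [u] exists for
    square [V] (a kernel vector, or the solution of [(V u)_i = sqrt B_ii]), and
    for a 3 x 2 matrix [V]: the rows of [V] are three points of the Bloch
    sphere, and the axis of the circle through them is the direction [u].
    Hence for n = 2, 3 the matrix [B] is a sum of [x_k x_k^*] with
    [|x_k,i|^2] proportional to [B_ii].  Each [x_k] is therefore largest at the
    index [i0] where [B_ii] is, and the sum of the [||x_k||^2] is [B_i0i0],
    which is a lower bound for the injective norm. *)
Require Import Defs.
From mathcomp Require Import all_boot all_order all_algebra.
From mathcomp Require Import complex.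
From mathcomp Require Import all_classical all_reals all_analysis.
From HB Require Import structures.
From mathcomp Require Import sesquilinear spectral ring lra.

Set Implicit Arguments.
Unset Strict Implicit.
Unset Printing Implicit Defensive.

Import Order.TTheory GRing.Theory Num.Theory Num.Def.
Import numFieldNormedType.Exports.

Local Open Scope classical_set_scope.
Local Open Scope ring_scope.
Local Open Scope sesquilinear_scope.

(** * Splitting [V V^*] into rank one terms whose moduli follow a given diagonal *)

Section RankOneDecomposition.
Variable C : numClosedFieldType.

Lemma trmxC_mul m n p (A : 'M[C]_(m, n)) (B : 'M[C]_(n, p)) :
  (A *m B)^t* = B^t* *m A^t*.
Proof. by rewrite trmx_mul map_mxM. Qed.

Lemma mulmx_trmxC_diag m n (A : 'M[C]_(m, n)) i :
  (A *m A^t*) i i = \sum_j `|A i j| ^+ 2.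
Proof. by rewrite !mxE; apply: eq_bigr => j _; rewrite !mxE normCK. Qed.

Lemma mulmx_trmxC_cV m (x : 'cV[C]_m) i : (x *m x^t*) i i = `|x i 0| ^+ 2.
Proof. by rewrite mulmx_trmxC_diag big_ord1. Qed.

(** Spectral theorem: [B = P^* D P] with [P] unitary. Testing the form on the columns of [P^*] shows
    that the eigenvalues are nonnegative, so [V = P^* sqrt D] works. *)
Lemma nonneg_definite_factor n (B : 'M[C]_n) :
  B \is hermsymmx ->
  (forall u : 'cV[C]_n, 0 <= ((map_mx conjC u)^T *m B *m u) 0 0) ->
  exists V : 'M[C]_n, B = V *m V^t*.
Proof.
move=> Bherm Bpos; have /hermitian_normalmx/orthomx_spectralP := Bherm.
set P := spectralmx B; set d := spectral_diag B => Beq.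
have Pu : P \is unitarymx := spectral_unitarymx B.
have PP : P *m P^t* = 1%:M by apply/unitarymxP.
rewrite invmx_unitary // in Beq.
have d_ge0 i : 0 <= d 0 i.
  have := Bpos (P^t* *m delta_mx i 0).
  rewrite map_trmx trmxC_mul trmxCK {1}Beq !mulmxA -[_ *m P *m P^t*]mulmxA PP mulmx1.
  by rewrite trmx_delta map_delta_mx -!rowE -row_mul PP row1 -rowE -colE !mxE eqxx mulr1n.
exists (P^t* *m diag_mx (map_mx sqrtC d)).
rewrite trmxC_mul trmxCK tr_diag_mx map_diag_mx -!mulmxA [diag_mx _ *m (_ *m _)]mulmxA.
rewrite mulmx_diag {1}Beq -mulmxA; congr (_ *m (diag_mx _ *m _)).
apply/rowP => i; rewrite !mxE /= geC0_conj ?sqrtC_ge0 //.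
by rewrite -expr2 sqrtCK.
Qed.

(** Gram-Schmidt on a matrix with first row [u^*] gives a unitary [P]. Inserting [P^* P = 1] between
    [V] and [V^*] and separating the first row of [P] from the others yields the two terms. *)
Lemma unitary_split n r (V : 'M[C]_(n, 1 + r)) (u : 'cV[C]_(1 + r)) : u != 0 ->
  exists (c : C) (V' : 'M[C]_(n, r)),
    let x := V *m (c *: u) in V *m V^t* = x *m x^t* + V' *m V'^t*.
Proof.
move=> u_neq0; set A : 'M[C]_(1 + r) := col_mx (u^t*) 0.
have Pu : schmidt A \is unitarymx by exact: schmidt_unitarymx.
have := row_schmidt_sub A (lshift r 0); set P := schmidt A in Pu *.
rewrite (eq_bigl (pred1 (lshift r 0))); last first.
  by move=> k; apply/idP/eqP => [/=|->//]; rewrite leqn0 => /eqP k0; apply/val_inj.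
rewrite big_pred1_eq genmxE.
have -> : row (lshift r 0) A = u^t* by rewrite rowKu row_id.
have -> : row (lshift r 0) P = usubmx P.
  by apply/rowP => j; rewrite !mxE; congr (P _ _); apply/val_inj.
(* [u^*] is [a] times the first row of [P], so scaling [u] by the conjugate of [a^-1] gives the
   adjoint of that row. *)
move=> /sub_rVP[a ua].
have a_neq0 : a != 0.
  apply: contraNneq u_neq0 => a0; rewrite -[u]trmxCK ua a0 scale0r.
  by rewrite trmx0 map_mx0.
exists (a^-1^*), (V *m (dsubmx P)^t*) => /=.
have -> : a^-1^* *: u = (usubmx P)^t*.
  have -> : usubmx P = a^-1 *: u^t* by rewrite ua scalerA mulVf ?scale1r.
  by rewrite linearZ map_mxZ /= trmxCK.
rewrite !trmxC_mul !trmxCK !mulmxA -[_ *m usubmx P]mulmxA -[_ *m dsubmx P]mulmxA.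
rewrite -mulmxDl -mulmxDr.
suff -> : (usubmx P)^t* *m usubmx P + (dsubmx P)^t* *m dsubmx P = 1%:M.
  by rewrite mulmx1.
rewrite -mul_row_col -map_row_mx -tr_col_mx vsubmxK.
by apply: mulmx1C; apply/unitarymxP.
Qed.

(** Cross-multiplied, so that zeros of [d] are allowed; for [d = 0] the condition is vacuous. *)
Definition proportional n (d : 'I_n -> C) (x : 'I_n -> C) :=
  forall i j, x i * d j = x j * d i.

Definition sqnorms n (x : 'cV[C]_n) i := `|x i 0| ^+ 2.

Definition decomposable n (d : 'I_n -> C) (B : 'M[C]_n) :=
  exists s : seq 'cV[C]_n, B = \sum_(x <- s) x *m x^t* /\
    forall x, x \in s -> proportional d (sqnorms x).

(** Proportionality to [d] is linear, so it passes from the diagonals of [V V^*] and [x x^*] to that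
    of their difference [V' V'^*], which has a factor with one column less. *)
Lemma decomposable_step n r (d : 'I_n -> C) (V : 'M[C]_(n, 1 + r)) (u : 'cV[C]_(1 + r)) :
  proportional d (fun i => (V *m V^t*) i i) ->
  u != 0 -> proportional d (sqnorms (V *m u)) ->
  (forall V' : 'M[C]_(n, r), proportional d (fun i => (V' *m V'^t*) i i) ->
    decomposable d (V' *m V'^t*)) ->
  decomposable d (V *m V^t*).
Proof.
move=> Vd u0 ud IH; have [c [V' /= VV]] := unitary_split V u0.
set x := V *m (c *: u) in VV.
have xd : proportional d (sqnorms x).
  move=> i j; have := ud i j; rewrite /sqnorms /x -scalemxAr !mxE !normrM !exprMn => e.
  by rewrite -!(mulrA (`|c| ^+ 2)) e.
have V'd : proportional d (fun i => (V' *m V'^t*) i i).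
  have VVE k : (V *m V^t*) k k = sqnorms x k + (V' *m V'^t*) k k.
    by rewrite VV [LHS]mxE mulmx_trmxC_cV.
  by move=> i j; have := Vd i j; rewrite !VVE !mulrDl xd => /addrI.
have [s [sE sd]] := IH _ V'd; exists (x :: s); split; first by rewrite big_cons -sE.
by move=> y /[!inE] /orP[/eqP->|/sd].
Qed.

Lemma square_direction n (d : 'I_n.+1 -> C) (V : 'M[C]_n.+1) :
  (forall i, 0 <= d i) ->
  exists2 u : 'cV[C]_n.+1, u != 0 & proportional d (sqnorms (V *m u)).
Proof.
move=> d_ge0; have [Vu|] := boolP (V \in unitmx); last first.
  rewrite -unitmx_tr unitmxE unitfE negbK => /det0P[v v0 vV].
  exists v^T; first by rewrite -trmx0 (inj_eq trmx_inj).
  move=> i j; rewrite /sqnorms -[V *m _]trmxK trmx_mul trmxK vV trmx0 !mxE.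
  by rewrite normr0 expr0n !mul0r.
(* For [d = 0] the solution of [V u = sqrt d] would be zero, but then any nonzero [u] will do. *)
have [d0|d0] := boolP [forall i, d i == 0].
  exists (const_mx 1).
    apply/negP => /eqP/matrixP/(_ 0 0); rewrite !mxE => /eqP.
    by rewrite oner_eq0.
  by move=> i j; rewrite !(eqP (forallP d0 _)) !mulr0.
have [i di] := forallPn d0.
exists (invmx V *m \col_i sqrtC (d i)).
  apply: contraNneq di => /(congr1 (mulmx V)); rewrite mulKVmx // mulmx0.
  by move=> /matrixP/(_ i 0)/eqP; rewrite !mxE sqrtC_eq0.
move=> j k; rewrite /sqnorms mulKVmx // !mxE !ger0_norm ?sqrtC_ge0 //.
by rewrite !sqrtCK mulrC.
Qed.

Lemma decomposable1 n (d : 'I_n -> C) (V : 'M[C]_(n, 1)) :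
  proportional d (fun i => (V *m V^t*) i i) -> decomposable d (V *m V^t*).
Proof.
move=> Vd; exists [:: V]; split; first by rewrite big_seq1.
move=> x /[!inE] /eqP-> i j; rewrite /sqnorms -!mulmx_trmxC_cV; exact: Vd.
Qed.

End RankOneDecomposition.

Local Open Scope complex_scope.

(** * A direction for matrices with two columns, via the Bloch sphere *)

Section PlaneDirection.
Variable R : rcfType.
Local Notation Re := complex.Re.
Local Notation Im := complex.Im.

(* The components of the rank one matrix [v^* v], with [v] the row [(p, q)],
   on the Pauli matrices z, x, y and on the identity. *)
Definition bloch (p q : R[i]) (k : 'I_4) : R :=
  [:: Re p ^+ 2 + Im p ^+ 2 - (Re q ^+ 2 + Im q ^+ 2);
      2 * (Re p * Re q + Im p * Im q);
      2 * (Im p * Re q - Re p * Im q);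
      Re p ^+ 2 + Im p ^+ 2 + (Re q ^+ 2 + Im q ^+ 2)]`_k.

Lemma left_kernel m n (M : 'M[R]_(m, n)) : (n < m)%N ->
  exists2 z : 'rV[R]_m, z != 0 & z *m M = 0.
Proof.
move=> nm; have /rowV0Pn[z /sub_kermxP zM z0] : kermx M != 0.
  by rewrite -mxrank_eq0 mxrank_ker subn_eq0 -ltnNge (leq_ltn_trans (rank_leq_col M)).
by exists z.
Qed.

Lemma sqr_norm_combination (p q : R[i]) (s x y : R) :
  `|p * s%:C + q * (x +i* y)| ^+ 2 =
  (s ^+ 2 * (Re p ^+ 2 + Im p ^+ 2) + (x ^+ 2 + y ^+ 2) * (Re q ^+ 2 + Im q ^+ 2)
   + s * (x * bloch p q 1 + y * bloch p q 2))%:C.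
Proof.
rewrite -add_Re2_Im2; case: p => p1 p2; case: q => q1 q2; congr (_%:C).
rewrite /bloch /=; ring.
Qed.

(** At most three vectors [bloch] in a space of dimension 4 satisfy a common linear relation
    [a Z + x X + y Y = c N], where [N] is the squared norm of the row of [V]. This is the plane that
    cuts the circle out of the sphere. *)
Lemma plane_direction n (d : 'I_n -> R[i]) (V : 'M[R[i]]_(n, 2)) : (n < 4)%N ->
  proportional d (fun i => (V *m V^t*) i i) ->
  exists2 u : 'cV[R[i]]_2, u != 0 & proportional d (sqnorms (V *m u)).
Proof.
move=> n4 Vd.
have [z z0 zM] := left_kernel (\matrix_(k, i) bloch (V i 0) (V i 1) k) n4.
(* [0 <= a] makes [rho + a], the first entry of [u], vanish only if
   [a = x = y = 0]. *)
pose w : 'rV[R]_4 := if 0 <= z 0 0 then z else - z.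
have w0 : w != 0 by rewrite /w; case: ifP; rewrite ?oppr_eq0.
have wM i : \sum_k w 0 k * bloch (V i 0) (V i 1) k = 0.
  have /matrixP/(_ 0 i) : w *m (\matrix_(k, i) bloch (V i 0) (V i 1) k) = 0.
    by rewrite /w; case: ifP; rewrite ?mulNmx zM ?oppr0.
  by rewrite !mxE => wMi; rewrite -[RHS]wMi; apply: eq_bigr => k _; rewrite !mxE.
have wa : 0 <= w 0 0.
  rewrite /w; case: ifPn => //; rewrite -ltNge mxE oppr_ge0; exact: ltW.
have {}wM i : w 0 0 * bloch (V i 0) (V i 1) 0 + w 0 1 * bloch (V i 0) (V i 1) 1
   + w 0 2 * bloch (V i 0) (V i 1) 2 = - w 0 3 * bloch (V i 0) (V i 1) 3.
  apply/eqP; rewrite mulNr -subr_eq0 opprK -[eqbRHS](wM i).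
  rewrite !big_ord_recl big_ord0 addr0 !addrA.
  by apply/eqP; repeat congr (_ + _); congr (w _ _ * bloch _ _ _); apply/val_inj.
set a := w 0 0 in wM wa; set x := w 0 1 in wM; set y := w 0 2 in wM.
set c := - w 0 3 in wM.
have NE i : (V *m V^t*) i i = (bloch (V i 0) (V i 1) 3)%:C.
  rewrite mulmx_trmxC_diag !big_ord_recl big_ord0 addr0 -!add_Re2_Im2 -rmorphD /=.
  by congr (_%:C); rewrite /bloch /=;
    congr (_ + (Re (V _ _) ^+ _ + Im (V _ _) ^+ _)); apply/val_inj.
(* [rho] is the positive eigenvalue of the traceless Hermitian matrix
   [[a, x - iy], [x + iy, -a]], and [u] below an eigenvector for it. *)
set rho := Num.sqrt (a ^+ 2 + x ^+ 2 + y ^+ 2).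
have rho2 : rho ^+ 2 = a ^+ 2 + x ^+ 2 + y ^+ 2.
  by rewrite sqr_sqrtr // !addr_ge0 ?sqr_ge0.
have rho_ge0 : 0 <= rho := sqrtr_ge0 _.
pose u : 'cV[R[i]]_2 := \col_k [:: (rho + a)%:C; x +i* y]`_k.
(* With [H] the Hermitian matrix above, [u u^* = (rho + a) (rho + H)]; on row [i] of [V] the form
   [H] takes the value [a Z + x X + y Y], which is [c N] by [wM]. *)
have uE i : sqnorms (V *m u) i = ((rho + a) * (rho + c) * bloch (V i 0) (V i 1) 3)%:C.
  rewrite /sqnorms mxE !big_ord_recl big_ord0 addr0 !mxE /=.
  rewrite (_ : lift _ _ = 1); last exact/val_inj.
  rewrite sqr_norm_combination; congr (_%:C).
  have -> : x ^+ 2 + y ^+ 2 = (rho + a) * (rho - a).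
    by rewrite mulrC -subr_sqr rho2; ring.
  rewrite -[RHS]mulrA [X in _ = _ * X]mulrDl -wM /bloch /=; ring.
have [ra|ra] := eqVneq (rho + a) 0; last first.
  exists u; last first.
    by move=> i j; have := Vd i j; rewrite !NE !uE !(rmorphM _ (_ * _)) /= -!mulrA => ->.
  apply: contraNneq ra => /matrixP/(_ 0 0); rewrite !mxE /= => -[->]; exact.
have [a0 r0] : a = 0 /\ rho = 0 by split; lra.
have [x0 y0] : x = 0 /\ y = 0.
  have := rho2; rewrite r0 a0; split; nra.
(* In this degenerate case only the last entry of [w] survives, so [wM] reads [0 = c N] for every
   row. Hence [V = 0], and any nonzero [u] will do. *)
have c0 : c != 0.
  rewrite oppr_eq0; apply: contraNneq w0 => w3; apply/eqP/rowP => k; rewrite mxE.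
  case: k => [[|[|[|[|//]]]] hk]; [rewrite -a0|rewrite -x0|rewrite -y0|rewrite -w3];
    by congr (w _ _); apply/val_inj.
have V0 : V = 0.
  have N0 i : (V *m V^t*) i i = 0.
    rewrite NE; have := wM i; rewrite a0 x0 y0 !mul0r !addr0 => /esym/eqP.
    by rewrite mulf_eq0 (negPf c0) => /eqP->.
  apply/matrixP => i k; rewrite mxE; have := N0 i; rewrite mulmx_trmxC_diag.
  move/eqP; rewrite psumr_eq0 => [/allP/(_ k)|? _]; last exact: exprn_ge0.
  by rewrite mem_index_enum sqrf_eq0 normr_eq0 => /(_ isT)/eqP.
exists (const_mx 1).
  apply/negP => /eqP/matrixP/(_ 0 0); rewrite !mxE => /eqP.
  by rewrite oner_eq0.
by move=> i j; rewrite /sqnorms V0 mul0mx !mxE normr0 expr0n !mul0r.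
Qed.
End PlaneDirection.

(** * Dual, injective and projective norms over [l_infty^n] *)

Section LinfNorms.
Variable R : realType.

Lemma rnormC (W : normedZmodType R[i]) (v : W) : (rnorm v)%:C = `|v|.
Proof. by rewrite /rnorm RRe_real// ger0_real. Qed.

Lemma rnorm_ge0 (W : normedZmodType R[i]) (v : W) : 0 <= rnorm v.
Proof. by rewrite -(@lecR R) rnormC normr_ge0. Qed.

Lemma ler_rnorm_sum (W : normedZmodType R[i]) I (s : seq I) (F : I -> W) :
  rnorm (\sum_(i <- s) F i) <= \sum_(i <- s) rnorm (F i).
Proof.
have sumC : (\sum_(i <- s) rnorm (F i))%:C = \sum_(i <- s) `|F i|.
  by rewrite rmorph_sum; apply: eq_bigr => i _; exact: rnormC.
rewrite -(@lecR R) sumC rnormC; exact: ler_norm_sum.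
Qed.

Lemma rnormZ (W : normedModType R[i]) (a : R[i]) (v : W) :
  rnorm (a *: v) = rnorm a * rnorm v.
Proof. by apply: (@complexI R); rewrite rmorphM /= !rnormC normrZ. Qed.

Lemma rnormM (a b : R[i]) : rnorm (a * b) = rnorm a * rnorm b.
Proof. by apply: (@complexI R); rewrite rmorphM /= !rnormC normrM. Qed.

Lemma rnorm_real (a : R) : 0 <= a -> rnorm a%:C = a.
Proof. by move=> a0; apply: (@complexI R); rewrite rnormC ger0_norm // ler0c. Qed.

Lemma rnorm_eq0 (W : normedZmodType R[i]) (v : W) : rnorm v = 0 -> v = 0.
Proof. by move=> v0; apply/eqP; rewrite -normr_eq0 -rnormC v0. Qed.

Variable n : nat.
Implicit Types (x v : 'rV[R[i]]_n) (A : 'M[R[i]]_n) (l : {scalar 'rV[R[i]]_n}).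

Local Notation e := (@canonical_basis R n).

Lemma rnorm_coord_le x i : rnorm (x 0 i) <= rnorm x.
Proof. rewrite [leRHS]rnorm_linfE; exact: (le_bigmax _ (fun i => rnorm (x 0 i))). Qed.

Lemma rnorm_linf_le x M : 0 <= M -> (forall i, rnorm (x 0 i) <= M) -> rnorm x <= M.
Proof. by move=> M0 xM; rewrite rnorm_linfE; apply/bigmax_leP; split. Qed.

(** A [sup] dominates the values only over a bounded set; the bound here is the l_1 norm of the
    coefficients of [l]. *)
Lemma unit_ball_has_ubound l :
  has_ubound [set rnorm (l v) | v in [set v : 'rV[R[i]]_n | rnorm v <= 1]].
Proof.
exists (\sum_i rnorm (l (e i))) => _ [v /= v1 <-].
rewrite [v]row_sum_delta linear_sum (le_trans (ler_rnorm_sum _ _)) //.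
apply: ler_sum => i _; rewrite scalarZ rnormM ler_piMl ?rnorm_ge0 //.
exact: le_trans (rnorm_coord_le v i) v1.
Qed.

Lemma ler_dual_norm l v : rnorm (l v) <= dual_norm l * rnorm v.
Proof.
have [/eqP/rnorm_eq0->|v0] := boolP (rnorm v == 0).
  by rewrite linear0 /rnorm !normr0 mulr0.
have v_gt0 : 0 < rnorm v by rewrite lt_def v0 rnorm_ge0.
rewrite -ler_pdivrMr // mulrC.
have rv_ge0 : 0 <= (rnorm v)^-1 by rewrite invr_ge0 ltW.
rewrite -{1}(rnorm_real rv_ge0) -rnormM -scalarZ.
apply: ub_le_sup; first exact: unit_ball_has_ubound.
exists ((rnorm v)^-1%:C *: v) => //=.
by rewrite rnormZ rnorm_real // mulVf.
Qed.

Definition coordinate (i : 'I_n) (v : 'rV[R[i]]_n) : R[i] := v 0 i.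

Fact coordinate_is_scalar i : scalar (coordinate i).
Proof. by move=> a u v; rewrite /coordinate !mxE. Qed.

HB.instance Definition _ i :=
  GRing.isLinear.Build R[i] 'rV[R[i]]_n R[i] *%R (coordinate i)
    (coordinate_is_scalar i).

Lemma dual_norm_coordinate i : dual_norm (coordinate i : {scalar 'rV[R[i]]_n}) = 1.
Proof.
have ei : rnorm (coordinate i (e i)) = 1.
  by rewrite /coordinate mxE !eqxx (rnorm_real ler01).
apply/eqP; rewrite eq_le; apply/andP; split.
  apply: ge_sup; first by
    exists (rnorm (coordinate i 0)), 0 => //=; rewrite /rnorm normr0.
  by move=> _ [v /= v1 <-]; apply: le_trans (rnorm_coord_le _ _) v1.
apply: ub_le_sup; first exact: unit_ball_has_ubound.
exists (e i) => //=; apply: rnorm_linf_le => // j.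
rewrite mxE eqxx /=; case: eqP => _; first by rewrite (rnorm_real ler01).
by rewrite /rnorm normr0.
Qed.

Lemma tensor_apply_coord A l j : tensor_apply e A l 0 j = \sum_i A i j * l (e i).
Proof.
rewrite /tensor_apply summxE; apply: eq_bigr => i _.
have -> : \sum_k (A i k * l (e i)) *: e k = \row_k (A i k * l (e i)).
  by rewrite [RHS]row_sum_delta; apply: eq_bigr => k _; rewrite mxE.
by rewrite mxE.
Qed.

Lemma tensor_apply_decomposition A s l : tensor_decomposition A s ->
  tensor_apply e A l = \sum_(p <- s) l p.1 *: p.2.
Proof.
move=> ->; apply/rowP => j; rewrite tensor_apply_coord summxE.
under eq_bigr do rewrite summxE mulr_suml.
rewrite exchange_big; apply: eq_bigr => p _ /=.
rewrite [in RHS](row_sum_delta p.1) linear_sum !mxE mulr_suml.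
by apply: eq_bigr => i _; rewrite !mxE big_ord1 !mxE scalarZ mulrAC.
Qed.

Lemma ler_tensor_apply A s l : tensor_decomposition A s -> dual_norm l = 1 ->
  rnorm (tensor_apply e A l) <=
  \sum_(p <- s) rnorm (of_coords e p.1) * rnorm (of_coords e p.2).
Proof.
move=> As l1; rewrite (tensor_apply_decomposition _ As).
rewrite (le_trans (ler_rnorm_sum _ _)) //; apply: ler_sum => p _.
rewrite !of_coords_canonical rnormZ ler_wpM2r ?rnorm_ge0 //.
by have := ler_dual_norm l p.1; rewrite l1 mul1r.
Qed.

Lemma injective_norm_set_nonempty A (i : 'I_n) :
  [set rnorm (tensor_apply e A l) |
    l in [set l : {scalar 'rV[R[i]]_n} | dual_norm l = 1]] !=set0.
Proof. by eexists; exists (coordinate i) => //; exact: dual_norm_coordinate. Qed.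

(** The index [i] provides a form of dual norm 1 and [s] a decomposition, so neither the supremum
    nor the infimum is taken over an empty set. *)
Lemma injective_le_projective A s (i : 'I_n) : tensor_decomposition A s ->
  injective_norm e A <= projective_norm e A.
Proof.
move=> As; apply: lb_le_inf; first by eexists; exists s.
move=> _ [t /= At <-]; apply: ge_sup; first exact: injective_norm_set_nonempty.
by move=> _ [l /= l1 <-]; exact: ler_tensor_apply.
Qed.

(** The [i]-th coordinate form has dual norm 1 and reads off row [i] of the transpose of [A], whose
    [i]-th entry is [A i i]; [s] bounds the set under the supremum. *)
Lemma ler_diag_injective A s i : tensor_decomposition A s ->
  rnorm (A i i) <= injective_norm e A.
Proof.
move=> As; have -> : A i i = tensor_apply e A (coordinate i) 0 i.
  rewrite tensor_apply_coord (bigD1 i) //= big1 => [|j ji].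
    by rewrite /coordinate mxE !eqxx mulr1 addr0.
  by rewrite /coordinate mxE eq_sym (negPf ji) andbF mulr0.
apply: le_trans (rnorm_coord_le _ _) _; apply: ub_le_sup.
  by eexists => _ [l /= l1 <-]; exact: (ler_tensor_apply As).
by exists (coordinate i) => //; exact: dual_norm_coordinate.
Qed.

Lemma projective_norm_le A s : tensor_decomposition A s ->
  projective_norm e A <= \sum_(p <- s) rnorm p.1 * rnorm p.2.
Proof.
move=> As; under eq_bigr do
  rewrite -{1}(of_coords_canonical _.1) -{1}(of_coords_canonical _.2).
apply: ge_inf; last by exists s.
by exists 0 => _ [t _ <-]; apply: sumr_ge0 => p _; rewrite mulr_ge0 ?rnorm_ge0.
Qed.

Lemma projective_eq_injective (B : 'M[R[i]]_n) (i : 'I_n) :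
  decomposable (fun i => B i i) B -> projective_norm e B = injective_norm e B.
Proof.
case=> s [BE sB].
(* Tensors carry no conjugation, so [x x^*] is the tensor of [x] with its conjugate, which has the
   same norm. *)
pose t := [seq (x^T, x^t*) | x : 'cV_n <- s].
have Bt : tensor_decomposition B t.
  by rewrite /tensor_decomposition big_map BE; apply: eq_bigr => x _; rewrite trmxK.
have diagE k : B k k = (\sum_(x <- s) rnorm (x k 0) ^+ 2)%:C.
  rewrite BE summxE rmorph_sum; apply: eq_bigr => x _.
  by rewrite mulmx_trmxC_cV rmorphXn /= rnormC.
pose N k := \sum_(x <- s) rnorm (x k 0) ^+ 2.
pose i0 := [arg max_(k > i) N k]%O.
have Nmax k : N k <= N i0 by rewrite /i0; case: arg_maxP => // j _; apply.
have xmax (x : 'cV_n) k : x \in s -> rnorm (x k 0) <= rnorm (x i0 0).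
  move=> xs; rewrite -(@ler_pXn2r _ 2) ?nnegrE ?rnorm_ge0 //.
  have := sB _ xs k i0; rewrite /sqnorms -!rnormC -!rmorphXn !diagE.
  rewrite -!rmorphM => /complexI.
  (* If the largest diagonal entry is zero, all [x k 0] vanish. Otherwise [|x_k|^2 N i0 = |x_i0|^2 N
     k <= |x_i0|^2 N i0], and [N i0] cancels. *)
  have [N0 _|N0] := eqVneq (N i0) 0.
    have /eqP : N k = 0.
      by apply/eqP; rewrite eq_le -{1}N0 Nmax sumr_ge0 // => y _; rewrite sqr_ge0.
    rewrite psumr_eq0 => [/allP/(_ _ xs) /= /eqP->|y _]; exact: sqr_ge0.
  have N_gt0 : 0 < N i0 by rewrite lt_def N0 sumr_ge0 // => y _; exact: sqr_ge0.
  move=> xN; rewrite -(ler_pM2r N_gt0) xN ler_wpM2l ?sqr_ge0 //; exact: Nmax.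
apply/eqP; rewrite eq_le (injective_le_projective i Bt) andbT.
apply: le_trans (ler_diag_injective i0 Bt).
apply: le_trans (projective_norm_le Bt) _.
rewrite diagE rnorm_real ?sumr_ge0 // => [|x _]; last exact: sqr_ge0.
rewrite big_map; rewrite [leLHS]big_seq [leRHS]big_seq; apply: ler_sum => x xs /=.
rewrite expr2 ler_pM ?rnorm_ge0 //; apply: rnorm_linf_le; rewrite ?rnorm_ge0 // => k.
  by rewrite mxE xmax.
by rewrite !mxE {1}/rnorm norm_conjC -/(rnorm _) xmax.
Qed.

End LinfNorms.

Theorem theorem3p2 (R : realType) :
  @property_Q R (linf R 2) 2 (@canonical_basis R 2) /\
  @property_Q R (linf R 3) 3 (@canonical_basis R 3).
Proof.
split=> B [Bherm Bpos]; apply: (projective_eq_injective 0);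
  have [V VE] := nonneg_definite_factor Bherm Bpos;
  have Vd : proportional (fun i => B i i) (fun i => (V *m V^t*) i i)
    by move=> i j; rewrite -VE mulrC.
all: have d_ge0 i : 0 <= B i i by
  rewrite VE mulmx_trmxC_diag sumr_ge0 // => j _; exact: exprn_ge0.
all: have [u u0 uV] := square_direction V d_ge0; rewrite [X in decomposable _ X]VE.
  (* For [n = 2], one step leaves a single column, which is already a rank one term. *)
  apply: (@decomposable_step _ _ 1 _ V u) => //; exact: decomposable1.
(* For [n = 3], the square step leaves a 3 x 2 factor [W], and the Bloch sphere direction then
   leaves a single column. *)
apply: (@decomposable_step _ _ 2 _ V u) => // W Wd.
have [v v0 vW] := plane_direction (isT : 3 < 4)%N Wd.
apply: (@decomposable_step _ _ 1 _ W v) => //; exact: decomposable1.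
Qed.
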